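(* Let $X_1,X_2,\ldots$ be non-negative independent random variables with distributions $F_1,F_2,\ldots$ respectively. Assume that $F_1\in\mathcal{OA}$ and that, for every integer $l>1$, $$0<\liminf_{x\to\infty}\frac{\overline F_l(x)}{\overline F_1(x)}\le\limsup_{x\to\infty}\frac{\overline F_l(x)}{\overline F_1(x)}<\infty .$$ Let $N$ be a discrete random variable with values in $\{0,1,\ldots,k\}$ for some $k\in\mathbb{N}$, with $\mathbf{P}[N=0]<1$, independent of $X_1,X_2,\ldots$. Then the distribution $F_{S_N}$ of the randomly stopped sum $S_N:=\sum_{i=1}^NX_i$ (with $S_0:=0$) satisfies $F_{S_N}\in\mathcal{OA}$.
   Context: For a distribution $F$, $\overline F(x)=1-F(x)$ denotes its tail; all the distributions $F_i$ satisfy $\overline F_i(x)>0$ for every $x\ge0$. $F^{*2}$ is the convolution of $F$ with itself. Classes of distributions: - $F\in\mathcal{P_D}$ (positively decreasing) if $\limsup_{x\to\infty}\overline F(vx)/\overline F(x)<1$ for some $v>1$. - $F\in\mathcal{OS}$ (generalized subexponential) if $\limsup_{x\to\infty}\overline{F^{*2}}(x)/\overline F(x)<\infty$. - $\mathcal{OA}:=\mathcal{OS}\cap\mathcal{P_D}$. *)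

(* Defs.v *)
From HB Require Import structures.
From mathcomp Require Import all_boot all_order all_algebra finmap.
From mathcomp Require Import all_classical all_reals all_analysis.
From mathcomp Require Import measurable_realfun.

Set Implicit Arguments.
Unset Strict Implicit.
Unset Printing Implicit Defensive.

Import Order.TTheory GRing.Theory Num.Theory.
Import numFieldNormedType.Exports.

Local Open Scope classical_set_scope.
Local Open Scope ring_scope.

(* Convolution of F and G: the law of x + y when (x, y) has law F \x G. *)
Section convolution.
Context {R : realType} (F G : probability R R).

Definition addpair (z : R * R) : R := z.1 + z.2.

Lemma measurable_addpair : measurable_fun [set: R * R] addpair.
Proof. by apply: measurable_funD; [exact: measurable_fst|exact: measurable_snd]. Qed.

HB.instance Definition _ :=
  isMeasurableFun.Build _ _ _ _ addpair measurable_addpair.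

Definition convolution : set R -> \bar R :=
  pushforward (F \x G)%E addpair.

Let convolution0 : convolution set0 = 0%E.
Proof. exact: measure0. Qed.

Let convolution_ge0 A : (0 <= convolution A)%E.
Proof. exact: measure_ge0. Qed.

Let convolution_sigma_additive : semi_sigma_additive convolution.
Proof. exact: measure_semi_sigma_additive. Qed.

HB.instance Definition _ := isMeasure.Build _ _ _ convolution
  convolution0 convolution_ge0 convolution_sigma_additive.

Let convolution_setT : convolution [set: R] = 1%E.
Proof.
rewrite /convolution /pushforward preimage_setT -setXTT.
by rewrite product_measure1E//= !probability_setT mule1.
Qed.

HB.instance Definition _ :=
  Measure_isProbability.Build _ _ _ convolution convolution_setT.

End convolution.

Section distribution_classes.
Context {R : realType}.
Implicit Type F : probability R R.

Definition tail F (x : R) : R := 1 - fine (F `]-oo, x]%classic).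

(* Quotients of tails only make sense for such distributions: in Rocq,
   a / 0 = 0. *)
Definition unbounded F := forall x : R, 0 <= x -> 0 < tail F x.

Definition positively_decreasing F :=
  unbounded F /\
  exists2 v : R, 1 < v &
    (limf_esup (fun x => (tail F (v * x) / tail F x)%:E) +oo%R < 1)%E.

Definition generalized_subexponential F :=
  unbounded F /\
  (limf_esup (fun x => (tail (convolution F F) x / tail F x)%:E) +oo%R
     < +oo)%E.

Definition OA F := generalized_subexponential F /\ positively_decreasing F.

End distribution_classes.

Section independence.
Context d (T : measurableType d) (R : realType) (P : probability T R).

Definition mutually_independent d' (T' : measurableType d') (I : choiceType)
    (X : I -> {RV P >-> T'}) :=
  forall (J : {fset I}) (A : I -> set T'), (forall i, measurable (A i)) ->
    P (\bigcap_(i in [set` J]) (X i @^-1` A i)) =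
    (\prod_(i <- J) P (X i @^-1` A i))%E.

Definition sigma_algebra_of_family d' (T' : measurableType d') (I : Type)
    (X : I -> {RV P >-> T'}) : set_system T :=
  <<s \bigcup_i preimage_set_system [set: T] (X i) measurable >>.

(* The sigma-algebra generated by Y is independent of the one generated by the
   whole family X. *)
Definition independent_of_family d1 (T1 : measurableType d1)
    d2 (T2 : measurableType d2) (I : Type)
    (Y : {RV P >-> T1}) (X : I -> {RV P >-> T2}) :=
  forall (B : set T1) (E : set T), measurable B ->
    sigma_algebra_of_family X E ->
    P ((Y @^-1` B) `&` E) = (P (Y @^-1` B) * P E)%E.

End independence.

(* Summands are indexed from 0: X i is the (i + 1)-st summand. *)
Section stopped_sum.
Context d (T : measurableType d) (R : realType) (P : probability T R).
Variables (X : nat -> {RV P >-> R}) (N : {RV P >-> nat}).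

Definition stopped_sum (t : T) : R := \sum_(i < N t) X i t.

Lemma measurable_stopped_sum : measurable_fun [set: T] stopped_sum.
Proof.
move=> _ A mA; rewrite setTI.
have -> : stopped_sum @^-1` A = \bigcup_n ((N @^-1` [set n]) `&`
    ((fun t => \sum_(i < n) X i t) @^-1` A)).
  apply/seteqP; split=> [t At|t [n _ [/= <-]]//]; by exists (N t).
apply: bigcup_measurable => n _; apply: measurableI.
  exact: measurable_funPTI.
rewrite -[X in measurable X]setTI.
by apply: (@measurable_sum _ _ _ _ _ (index_enum 'I_n) (fun i t => X i t)).
Qed.

HB.instance Definition _ :=
  isMeasurableFun.Build _ _ _ _ stopped_sum measurable_stopped_sum.

End stopped_sum.

(* Main.v *)
(* Write F <~ G when the tail of F is at most a constant times the tail of G.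
   Both classes defining OA are invariant under mutual domination: domination is
   compatible with convolution (apply it under the integral, one factor at a
   time), and for positive decrease one iterates v until the contraction beats
   the constants.  Since the summands are non-negative, S_N <= S_k, and
   S_N >= X_1 on the event N <> 0, which is independent of X_1; hence
   F_1 <~ F_(S_N) <~ F_(S_k).  Finally F_(S_n) <~ F_1 by induction on n, because
   F_(S_(n+1)) = F_(S_n) * F_(n+1) <~ F_1 * F_1 <~ F_1. *)

Require Import Defs.
From HB Require Import structures.
From mathcomp Require Import all_boot all_order all_algebra finmap.
From mathcomp Require Import all_classical all_reals all_analysis.
From mathcomp Require Import measurable_realfun.

Set Implicit Arguments.
Unset Strict Implicit.
Unset Printing Implicit Defensive.

Import Order.TTheory GRing.Theory Num.Theory.
Import numFieldNormedType.Exports.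

Local Open Scope classical_set_scope.
Local Open Scope ring_scope.

(** * Real bounds from limits superior, and domination of tails *)

Section tail_domination.
Context {R : realType}.
Implicit Types F G H : probability R R.

Lemma limf_esup_EFin_lt (f : R -> R) (a : \bar R) (B : set_system R)
    {FB : Filter B} :
  (limf_esup (fun x => (f x)%:E) B < a)%E ->
  exists2 r : R, (r%:E < a)%E & \forall x \near B, f x <= r.
Proof.
rewrite limf_esupE => /ereal_inf_lt[_ [V BV <-]] supV.
have le_sup x : V x -> ((f x)%:E <= ereal_sup ((fun x => (f x)%:E) @` V))%E.
  by move=> Vx; apply: ereal_sup_ubound; exists x.
move: supV le_sup; case: (ereal_sup _) => [s| |] supV le_sup.
- by exists s => //; apply: filterS BV => x /le_sup; rewrite lee_fin.
- by rewrite ltNge leey in supV.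
(* A supremum of real values is [-oo] only if [V] is empty, so any real below [a] serves. *)
- have VF x : V x -> False by move=> /le_sup.
  case: a supV => [r| |] // _.
  + by exists (r - 1); [rewrite lte_fin ltrBlDr ltrDl|apply: filterS BV => x /VF].
  + by exists 0; [exact: ltry|apply: filterS BV => x /VF].
Qed.

Lemma limf_esup_EFin_le (f : R -> R) (r : R) (B : set_system R) :
  (\forall x \near B, f x <= r) -> (limf_esup (fun x => (f x)%:E) B <= r%:E)%E.
Proof.
move=> Bf; rewrite limf_esupE; apply: ge_ereal_inf.
exists (ereal_sup ((fun x => (f x)%:E) @` [set x | f x <= r])).
  by exists [set x | f x <= r].
by apply: ge_ereal_sup => _ [x fx <-]; rewrite lee_fin.
Qed.

Lemma EFin_tail F x : (tail F x)%:E = F `]x, +oo[%classic.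
Proof.
rewrite /tail EFinB fineK ?fin_num_measure//.
by rewrite -probability_setC//= setCitvl.
Qed.

Lemma tail_ge0 F x : 0 <= tail F x.
Proof. by rewrite -lee_fin EFin_tail. Qed.

Lemma tail_le1 F x : tail F x <= 1.
Proof. by rewrite -lee_fin EFin_tail probability_le1. Qed.

Lemma tail_nonincreasing F : {homo tail F : x y / x <= y >-> y <= x}.
Proof.
move=> x y xy; rewrite -lee_fin !EFin_tail le_measure ?inE//.
by apply: subset_itvr; rewrite bnd_simp.
Qed.

(** The bound is asked at every real [x], not just eventually, so that it can be used under an
    integral at the points [x - u]. *)
Definition dominated F G :=
  exists2 C, 0 < C & forall x, tail F x <= C * tail G x.

Lemma dominated_trans F G H : dominated F G -> dominated G H -> dominated F H.
Proof.
move=> [C C0 FG] [D D0 GH]; exists (C * D); first exact: mulr_gt0.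
by move=> x; rewrite (le_trans (FG x))// -mulrA ler_wpM2l// ltW.
Qed.

(** Beyond a threshold the ratio bound applies; up to it, [tail F] is at most 1 while [tail G] is at
    least its positive value at the threshold. *)
Lemma dominated_of_bounded_ratio F G : unbounded G ->
  (exists r, \forall x \near +oo, tail F x / tail G x <= r) -> dominated F G.
Proof.
move=> G0 [r [M [_ Mr]]].
(* The 0 makes [tail G y] positive, and [M + 1] puts every [x > y] in the range of the ratio
   bound. *)
pose y := Num.max 0 (M + 1); have Gy : 0 < tail G y by rewrite G0// le_max lexx.
exists (Num.max r (tail G y)^-1); first by rewrite lt_max invr_gt0 Gy orbT.
move=> x; have [xy|yx] := leP x y.
- have Gx : tail G y <= tail G x by exact: tail_nonincreasing.
  apply: (le_trans (tail_le1 _ _)).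
  apply: (@le_trans _ _ ((tail G y)^-1 * tail G x)).
    by rewrite mulrC ler_pdivlMr// mul1r.
  by rewrite ler_wpM2r ?tail_ge0// le_max lexx orbT.
- have x0 : 0 <= x by apply: ltW; apply: le_lt_trans yx; rewrite le_max lexx.
  rewrite -ler_pdivrMr ?G0// le_max Mr//.
  by apply: lt_trans yx; rewrite lt_max ltrDl ltr01 orbT.
Qed.

Lemma unbounded_of_dominated F G : unbounded F -> dominated F G -> unbounded G.
Proof.
move=> F0 [C C0 FG] x x0; have := lt_le_trans (F0 x x0) (FG x).
by rewrite pmulr_rgt0.
Qed.

(** * Tails of convolutions *)

Lemma tail_convolution F G x :
  ((tail (convolution F G) x)%:E = \int[F]_u (tail G (x - u))%:E)%E.
Proof.
rewrite EFin_tail /convolution /pushforward/= /product_measure1.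
apply: eq_integral => u _; rewrite EFin_tail/=; congr (G _).
apply/seteqP; split => v; rewrite /xsection/= inE/= /addpair/= !in_itv/= !andbT.
- by rewrite ltrBlDl.
- by rewrite ltrBlDl.
Qed.

Lemma tail_convolution_sym F G x :
  ((tail (convolution F G) x)%:E = \int[G]_v (tail F (x - v))%:E)%E.
Proof.
have mx : measurable (@addpair R @^-1` `]x, +oo[%classic).
  by rewrite -[X in measurable X]setTI; exact: measurable_addpair.
rewrite EFin_tail.
(* [F \x^ G] integrates in the other order; agreeing with [F \x G] on rectangles, it is the same
   measure. *)
have FG A B : measurable A -> measurable B -> (F \x^ G)%E (A `*` B) = (F A * G B)%E.
  exact: product_measure2E.
apply: (etrans (product_measure_unique FG mx)).
rewrite /= /product_measure2; apply: eq_integral => v _.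
rewrite EFin_tail/=; congr (F _).
by apply/seteqP; split => u;
  rewrite /ysection/= inE/= /addpair/= !in_itv/= !andbT ltrBlDr.
Qed.

Lemma measurable_tail_sub F x :
  measurable_fun [set: R] (fun u : R => tail F (x - u)).
Proof.
apply: nondecreasing_measurable => //.
by move=> u v uv; apply: tail_nonincreasing; rewrite lerB.
Qed.

Lemma integral_tail_sub_le F G H C x : 0 < C ->
  (forall y, tail F y <= C * tail G y) ->
  (\int[H]_u (tail F (x - u))%:E <= C%:E * \int[H]_u (tail G (x - u))%:E)%E.
Proof.
have tail_sub_ge0 K u : setT u -> (0 <= (tail K (x - u))%:E)%E.
  by move=> _; rewrite lee_fin tail_ge0.
have m_tail_sub K : measurable_fun [set: R] (EFin \o (fun u => tail K (x - u))).
  by apply/measurable_EFinP; exact: measurable_tail_sub.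
move=> C0 FG; rewrite -ge0_integralZl_EFin//;
  [|exact: tail_sub_ge0|exact: m_tail_sub|exact: ltW].
apply: ge0_le_integral => //;
  [exact: tail_sub_ge0|exact: m_tail_sub| |].
  by apply: measurable_funeM; exact: m_tail_sub.
by move=> u _; rewrite -EFinM lee_fin.
Qed.

(** The intermediate law is [convolution G1 F2]: [F1] is replaced under the integral against [F2],
    then [F2] under the integral against [G1]. *)
Lemma dominated_convolution F1 F2 G1 G2 : dominated F1 G1 -> dominated F2 G2 ->
  dominated (convolution F1 F2) (convolution G1 G2).
Proof.
move=> [C C0 FG1] [D D0 FG2]; exists (C * D); first exact: mulr_gt0.
move=> x; rewrite -lee_fin tail_convolution_sym.
apply: (le_trans (integral_tail_sub_le _ _ C0 FG1)).
rewrite -tail_convolution_sym tail_convolution -mulrA EFinM.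
rewrite lee_pmul2l ?lte_fin// EFinM tail_convolution.
exact: integral_tail_sub_le.
Qed.

(** * Invariance of the two classes under mutual domination *)

Lemma generalized_subexponential_dominated F : generalized_subexponential F ->
  dominated (convolution F F) F.
Proof.
move=> [F0 /limf_esup_EFin_lt[r _ Fr]].
by apply: dominated_of_bounded_ratio => //; exists r.
Qed.

Lemma generalized_subexponential_equiv F G : dominated F G -> dominated G F ->
  generalized_subexponential F -> generalized_subexponential G.
Proof.
move=> FG GF OSF; split; first exact: unbounded_of_dominated OSF.1 FG.
have [C C0 GG] : dominated (convolution G G) G.
  apply: dominated_trans (dominated_convolution GF GF) _.
  exact: dominated_trans (generalized_subexponential_dominated OSF) FG.
apply: (@le_lt_trans _ _ C%:E); last exact: ltry.
apply: limf_esup_EFin_le; near=> x.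
rewrite ler_pdivrMr//; apply: (unbounded_of_dominated OSF.1 FG).
by near: x; apply: nbhs_pinfty_ge; exact: num_real.
Unshelve. all: by end_near. Qed.

(** As [v > 1] and [x > M >= 0], all the points [v ^+ n * x] stay beyond [M], so the ratio bound can
    be applied at each of them. *)
Lemma tail_ratio_iter F v r M : unbounded F -> 1 < v -> 0 <= M -> 0 <= r ->
  (forall x, M < x -> tail F (v * x) / tail F x <= r) ->
  forall n x, M < x -> tail F (v ^+ n * x) <= r ^+ n * tail F x.
Proof.
move=> F0 v1 M0 r0 Mr n x Mx; have x0 : 0 <= x by exact/ltW/(le_lt_trans M0).
elim: n => [|n IHn]; first by rewrite !expr0 !mul1r.
have xvn : x <= v ^+ n * x by rewrite ler_peMl// exprn_ege1// ltW.
rewrite exprS -mulrA exprS -mulrA.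
apply: (@le_trans _ _ (r * tail F (v ^+ n * x))); last by rewrite ler_wpM2l.
rewrite -ler_pdivrMr; first exact/Mr/(lt_le_trans Mx).
by apply: F0; exact: le_trans xvn.
Qed.

(** With [C] and [D] the two domination constants, [tail G (v ^+ n * x) <= D * C * r ^+ n * tail G
    x] for large [x]; since [r < 1], some [n] brings the factor below 1/2. *)
Lemma positively_decreasing_equiv F G : dominated F G -> dominated G F ->
  positively_decreasing F -> positively_decreasing G.
Proof.
move=> FG GF [F0 [v v1 /limf_esup_EFin_lt[r r1 Fr]]].
have G0 := unbounded_of_dominated F0 FG; split=> //.
(* Both bounds are raised to be nonnegative: [M] so that tails beyond it are positive, [r] so that
   its powers preserve inequalities. *)
have {Fr} [M [M0 Fr]] : exists M, 0 <= M /\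
    forall x, M < x -> tail F (v * x) / tail F x <= Num.max r 0.
  case: Fr => M [_ Mr]; exists (Num.max M 0).
  split; first by rewrite le_max lexx orbT.
  by move=> x; rewrite gt_max => /andP[Mx _]; rewrite le_max Mr.
have {}r1 : Num.max r 0 < 1 by rewrite gt_max ltr01 andbT -lte_fin.
have r0 : 0 <= Num.max r 0 by rewrite le_max lexx orbT.
move: (Num.max r 0) r1 r0 Fr => {}r r1 r0 Fr.
have [C C0 {}FG] := FG; have [D D0 {}GF] := GF.
have [n [n0 nr]] : exists n, (0 < n)%N /\ D * C * r ^+ n < 1 / 2.
  have rn : D * C * r ^+ n @[n --> \oo] --> D * C * 0.
    by apply: cvgMl_tmp; apply: cvg_expr; rewrite ger0_norm.
  rewrite mulr0 in rn.
  have [m _ mr] := cvgr_lt 0 rn (1 / 2) ltac:(by rewrite divr_gt0).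
  (* The successor keeps the exponent positive, as [1 < v ^+ n] requires. *)
  by exists m.+1; split=> //; apply: mr => /=.
exists (v ^+ n); first by rewrite exprn_egt1// -lt0n.
apply: (@le_lt_trans _ _ (1 / 2)%:E); last first.
  by rewrite lte_fin ltr_pdivrMr// mul1r ltr1n.
apply: limf_esup_EFin_le; near=> x.
have Gx : 0 < tail G x by apply: G0; near: x; apply: nbhs_pinfty_ge; exact: num_real.
have Fn : tail F (v ^+ n * x) <= r ^+ n * tail F x.
  apply: tail_ratio_iter Fr _ _ _ => //; near: x.
  by apply: nbhs_pinfty_gt; exact: num_real.
rewrite ler_pdivrMr//; apply: le_trans (GF _) _.
apply: (@le_trans _ _ (D * C * r ^+ n * tail G x)); last first.
  by rewrite ler_wpM2r ?tail_ge0// ltW.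
rewrite -!mulrA ler_wpM2l ?(ltW D0)//; apply: le_trans Fn _.
by rewrite mulrCA ler_wpM2l ?exprn_ge0.
Unshelve. all: by end_near. Qed.

Lemma OA_equiv F G : dominated F G -> dominated G F -> OA F -> OA G.
Proof.
move=> FG GF [OSF PDF].
split; first exact: generalized_subexponential_equiv OSF.
exact: positively_decreasing_equiv PDF.
Qed.

End tail_domination.

(** * Laws of partial sums of independent variables *)

Section sums_of_independent.
Context d (T : measurableType d) (R : realType) (P : probability T R).

(** On rectangles, the image under [(U, V)] of [P] restricted to [E] is the product of the law of
    [U], scaled by [P E], with the law of [V]. Uniqueness of product measures extends this to the
    preimage of [A] under addition. *)
Lemma add_independent_events (U V : {RV P >-> R}) (E : set T) :
  measurable E ->
  (forall A B, measurable A -> measurable B ->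
    P (U @^-1` A `&` V @^-1` B `&` E) =
    (P (U @^-1` A) * P (V @^-1` B) * P E)%E) ->
  forall A, measurable A ->
    P ((U \+ V) @^-1` A `&` E) =
    (convolution (distribution P U) (distribution P V) A * P E)%E.
Proof.
move=> mE UVE A mA; pose UV t := (U t, V t).
have mUV : measurable_fun setT UV by exact: measurable_fun_pair.
have mAA : measurable (@addpair R @^-1` A).
  by rewrite -[X in measurable X]setTI; exact: measurable_addpair.
pose p := NngNum (fine_ge0 (measure_ge0 P E)).
have pE : (p%:num%:E = P E)%E by rewrite fineK// fin_num_measure.
have mE' B C : measurable B -> measurable C ->
    pushforward (mrestr P mE) UV (B `*` C) =
    (mscale p (distribution P U) B * distribution P V C)%E.
  move=> mB mC; rewrite /mscale/= pE.
  rewrite -[LHS]/(P (U @^-1` B `&` V @^-1` C `&` E)) UVE//.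
  by rewrite muleC muleA.
have /(_ mUV _ mAA) := product_measure_unique mE'.
rewrite [RHS](_ : _ = P ((U \+ V) @^-1` A `&` E))//= => <-.
rewrite muleC -pE /convolution /pushforward /product_measure1.
rewrite ge0_integral_mscale//.
exact: measurable_fun_xsection.
Qed.

Fixpoint partial_sum (X : nat -> {RV P >-> R}) n : {RV P >-> R} :=
  if n is n'.+1 then partial_sum X n' \+ X n' else cst 0.

Lemma partial_sumE X n t : partial_sum X n t = \sum_(i < n) X i t.
Proof.
by elim: n => [|n IHn]; [rewrite big_ord0|rewrite big_ord_recr/= IHn].
Qed.

(** The induction invariant: it carries all finite families of later summands because adding [X n]
    consumes one of them. *)
Definition partial_sum_indep_next X n :=
  forall (J : {fset nat}) (B : nat -> set R) A,
    (forall i, i \in J -> (n <= i)%N) ->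
    (forall i, measurable (B i)) -> measurable A ->
    P (partial_sum X n @^-1` A `&` \bigcap_(i in [set` J]) (X i @^-1` B i)) =
    (P (partial_sum X n @^-1` A) *
     P (\bigcap_(i in [set` J]) (X i @^-1` B i)))%E.

Lemma partial_sum_convolution X n : mutually_independent X ->
  partial_sum_indep_next X n ->
  forall (J : {fset nat}) (B : nat -> set R) A,
    (forall i, i \in J -> (n < i)%N) ->
    (forall i, measurable (B i)) -> measurable A ->
    P (partial_sum X n.+1 @^-1` A `&` \bigcap_(i in [set` J]) (X i @^-1` B i)) =
    (convolution (distribution P (partial_sum X n)) (distribution P (X n)) A *
     P (\bigcap_(i in [set` J]) (X i @^-1` B i)))%E.
Proof.
move=> X_indep Sn_indep J B A Jn mB mA.
set E := \bigcap_(i in _) _.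
have mE : measurable E.
  by apply: bigcap_measurableType => i _; exact: measurable_funPTI.
have nJ : n \notin J by apply/negP => /Jn; rewrite ltnn.
apply: add_independent_events => // C D mC mD.
(* Inserting [D] at coordinate [n], which is not in [J], turns the event on [X n] and [E] into a
   single event to which the invariant applies. *)
pose B' i := if i == n then D else B i.
have mB' i : measurable (B' i) by rewrite /B'; case: ifP.
have B'J i : i \in J -> B' i = B i.
  by move=> iJ; rewrite /B'; case: eqP => // iN; rewrite iN (negbTE nJ) in iJ.
have B'E : \bigcap_(i in [set` (n |` J)%fset]) (X i @^-1` B' i) =
    X n @^-1` D `&` E.
  rewrite bigcap_fsetU1 {1}/B' eqxx; congr (_ `&` _).
  by apply: eq_bigcapr => i /= /B'J ->.
rewrite -setIA -B'E Sn_indep//; last first.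
  by move=> i; rewrite !inE => /orP[/eqP->//|/Jn/ltnW].
rewrite -muleA; congr (_ * _)%E; rewrite X_indep// big_fsetU1//= {1}/B' eqxx.
by congr (_ * _)%E; rewrite /E X_indep//; apply: eq_big_seq => i /B'J ->.
Qed.

Lemma partial_sumS_law X n A : mutually_independent X ->
  partial_sum_indep_next X n -> measurable A ->
  P (partial_sum X n.+1 @^-1` A) =
  convolution (distribution P (partial_sum X n)) (distribution P (X n)) A.
Proof.
move=> X_indep Sn_indep mA.
(* For the empty family the later event is the whole space, which leaves the law of the sum
   alone. *)
have Jn i : i \in (fset0 : {fset nat}) -> (n < i)%N by rewrite inE.
have := partial_sum_convolution X_indep Sn_indep Jn (fun=> measurableT) mA.
by rewrite set_fset0 bigcap_set0 setIT probability_setT mule1.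
Qed.

Lemma mutually_independent_partial_sum X n :
  mutually_independent X -> partial_sum_indep_next X n.
Proof.
move=> X_indep; elim: n => [|n IHn] J B A Jn mB mA.
  (* The empty sum is constantly 0, so the preimage of [A] is everything or nothing. *)
  have [A0|A0] := pselect (A 0).
    have -> : partial_sum X 0 @^-1` A = setT by apply/seteqP; split.
    by rewrite setTI probability_setT mul1e.
  have -> : partial_sum X 0 @^-1` A = set0 by apply/seteqP; split.
  by rewrite set0I measure0 mul0e.
by rewrite partial_sum_convolution// -partial_sumS_law.
Qed.

Lemma dominated_partial_sum X n F : mutually_independent X ->
  generalized_subexponential F ->
  (forall l, dominated (distribution P (X l)) F) ->
  dominated (distribution P (partial_sum X n)) F.
Proof.
move=> X_indep OSF XF; elim: n => [|n IHn].
  apply: dominated_of_bounded_ratio; first exact: OSF.1.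
  (* The law of the empty sum has zero tail on the positive axis, so the ratio is 0 there. *)
  exists 0, 0; split=> // x x0.
  suff -> : tail (distribution P (partial_sum X 0)) x = 0.
    by rewrite mul0r.
  apply: EFin_inj; rewrite EFin_tail; apply: etrans (measure0 P); congr (P _).
  by apply/seteqP; split=> // t /=; rewrite in_itv/= andbT ltNge (ltW x0).
have [C C0 convF] : dominated (convolution (distribution P (partial_sum X n))
    (distribution P (X n))) F.
  apply: dominated_trans (generalized_subexponential_dominated OSF).
  exact: dominated_convolution.
exists C => // x; apply: le_trans (convF x).
rewrite -lee_fin !EFin_tail le_eqVlt.
apply/orP; left; apply/eqP/partial_sumS_law => //.
exact: mutually_independent_partial_sum.
Qed.

End sums_of_independent.

(** * Bounding the stopped sum from above and below *)

Section randomly_stopped_sum.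
Context d (T : measurableType d) (R : realType) (P : probability T R).
Variables (X : nat -> {RV P >-> R}) (N : {RV P >-> nat}).
Hypothesis X_ge0 : forall l t, 0 <= X l t.

Lemma dominated_stopped_sum_le k : (forall t, (N t <= k)%N) ->
  dominated (distribution P (stopped_sum X N)) (distribution P (partial_sum X k)).
Proof.
move=> Nk; exists 1 => // x; rewrite mul1r -lee_fin !EFin_tail.
apply: (le_measure P); rewrite ?inE//; [exact: measurable_funPTI..|].
move=> t /=; rewrite !in_itv/= !andbT => /lt_le_trans; apply.
rewrite partial_sumE /stopped_sum.
(* As sums over ranges of naturals, the two differ by the nonnegative terms from [N t] to [k]. *)
rewrite -[leLHS](big_mkord xpredT (fun i => X i t)).
rewrite -[leRHS](big_mkord xpredT (fun i => X i t)) (big_cat_nat _ (Nk t))//=.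
by rewrite lerDl sumr_ge0.
Qed.

Lemma dominated_stopped_sum_ge : independent_of_family N X ->
  (P [set t | N t = 0%N] < 1)%E ->
  dominated (distribution P (X 0%N)) (distribution P (stopped_sum X N)).
Proof.
move=> N_indep N0.
have mN0 : measurable [set t | N t = 0%N].
  exact: (@measurable_funPTI _ _ _ _ N [set 0%N]).
pose q := fine (P (N @^-1` ~` [set 0%N])).
have qE : (q%:E = P (N @^-1` ~` [set 0%N]))%E.
  by rewrite fineK// fin_num_measure//; exact: measurable_funPTI.
have q0 : 0 < q.
  by rewrite -lte_fin qE -preimage_setC probability_setC// sube_gt0.
(* With [q] the probability of [N <> 0], independence gives [q * P(X 0 > x) = P(N <> 0, X 0 > x)],
   which is at most [P(S_N > x)]. *)
exists q^-1; first by rewrite invr_gt0.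
move=> x; rewrite ler_pdivlMl// -lee_fin EFinM qE !EFin_tail.
have XE : sigma_algebra_of_family X (X 0%N @^-1` `]x, +oo[%classic).
  apply: sub_sigma_algebra; exists 0%N => //.
  by exists `]x, +oo[%classic => //; rewrite setTI.
rewrite /distribution /pushforward -N_indep//.
apply: (le_measure P); rewrite ?inE//.
- by apply: measurableI; exact: measurable_funPTI.
- exact: measurable_funPTI.
move=> t [/= /eqP Nt]; rewrite !in_itv/= !andbT => /lt_le_trans; apply.
rewrite /stopped_sum; case: (N t) Nt => // n _.
by rewrite big_ord_recl lerDl sumr_ge0.
Qed.

End randomly_stopped_sum.

(* X l has distribution F_(l + 1); in particular F_1 is that of X 0. *)
Theorem corollary2p2 (R : realType) (d : measure_display)
    (T : measurableType d) (P : probability T R)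
    (X : nat -> {RV P >-> R}) (N : {RV P >-> nat}) (k : nat)
    (X_ge0 : forall l t, 0 <= X l t)
    (X_indep : mutually_independent X)
    (X_unbounded : forall l, unbounded (distribution P (X l)))
    (X0_OA : OA (distribution P (X 0%N)))
    (X_liminf : forall l, (0 < l)%N ->
      (0 < limf_einf (fun x => (tail (distribution P (X l)) x /
                                tail (distribution P (X 0%N)) x)%:E) +oo%R)%E)
    (X_limsup : forall l, (0 < l)%N ->
      (limf_esup (fun x => (tail (distribution P (X l)) x /
                            tail (distribution P (X 0%N)) x)%:E) +oo%R
         < +oo)%E)
    (N_le : forall t, (N t <= k)%N)
    (N_neq0 : (P [set t | N t = 0%N] < 1)%E)
    (N_indep : independent_of_family N X) :
  OA (distribution P (stopped_sum X N)).
Proof.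
have X0_OS := X0_OA.1.
apply: OA_equiv X0_OA; first exact: dominated_stopped_sum_ge.
apply: dominated_trans (dominated_stopped_sum_le X_ge0 N_le) _.
(* The first summand dominates itself with constant 1; the others use their limit superior. *)
apply: dominated_partial_sum => // -[|l]; first by exists 1 => // x; rewrite mul1r.
have [r _ Xr] := limf_esup_EFin_lt (X_limsup l.+1 isT).
by apply: dominated_of_bounded_ratio; [exact: X_unbounded|exists r].
Qed.
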